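(* There is a function $\varepsilon:\mathbb{N}\to\mathbb{R}$ with $\varepsilon(n)\to 0$ as $n\to\infty$ such that for every $n\ge 2$ Client has a winning strategy in the unbiased Waiter-Client maximum degree game $WC_\Delta(n,D)$ with $$D=\frac{n}{2}+(1+\varepsilon(n))\sqrt{\frac{n\ln n}{2}}.$$
   Context: The game $WC_\Delta(n,D)$ (unbiased, i.e. bias $q=1$) is a two-player perfect information game played on the edges of the complete graph $K_n$. In each round Waiter offers Client $2$ edges of $K_n$ that have not been previously offered; Client claims one of them and Waiter claims the other. When fewer than $2$ not previously offered edges remain, Waiter claims all of them and the game ends. Client wins if and only if at the end of the game every vertex has degree smaller than $D$ in the graph formed by the edges claimed by Client; otherwise Waiter wins. Here $D$ is a real threshold. *)

(* Defs.v *)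
From mathcomp Require Import all_boot all_order all_algebra.
From mathcomp Require Import all_classical all_reals all_analysis.

Set Implicit Arguments.
Unset Strict Implicit.
Unset Printing Implicit Defensive.

Import Order.TTheory GRing.Theory Num.Theory.
Import numFieldNormedType.Exports.

Definition edge (n : nat) : finType := {e : {set 'I_n} | #|e| == 2}.

(* One round is the set of edges offered by Waiter, with the edge of that set
   claimed by Client; Waiter gets the other one.  A history lists the rounds
   in chronological order. *)
Definition history (n : nat) : Type := seq ({set edge n} * edge n).

Definition offered (n : nat) (h : history n) : {set edge n} :=
  \bigcup_(r <- h) r.1.

Definition client_graph (n : nat) (h : history n) : {set edge n} :=
  [set e in [seq r.2 | r <- h]].

Definition degree (n : nat) (G : {set edge n}) (v : 'I_n) : nat :=
  #|[set e in G | v \in val e]|.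

Definition legal_offer (n : nat) (h : history n) (o : {set edge n}) : bool :=
  (#|o| == 2) && [disjoint o & offered h].

(* The edges left over at this point all go to Waiter, so they do not affect
   Client's graph. *)
Definition game_over (n : nat) (h : history n) : bool :=
  #|~: offered h| < 2.

Definition client_strategy (n : nat) : Type :=
  history n -> {set edge n} -> edge n.

Definition legal_strategy (n : nat) (s : client_strategy n) : Prop :=
  forall (h : history n) (o : {set edge n}), legal_offer h o -> s h o \in o.

(* The histories that can arise when Client follows s and Waiter plays
   arbitrary legal offers. *)
Inductive reachable (n : nat) (s : client_strategy n) : history n -> Prop :=
| reachable_nil : reachable s [::]
| reachable_rcons (h : history n) (o : {set edge n}) :
    reachable s h -> legal_offer h o -> reachable s (rcons h (o, s h o)).

Definition client_wins (R : realType) (n : nat) (D : R) (h : history n) : Prop :=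
  forall v : 'I_n, ((degree (client_graph h) v)%:R < D)%R.

Definition winning_strategy (R : realType) (n : nat) (D : R)
    (s : client_strategy n) : Prop :=
  legal_strategy s /\
  forall h : history n, reachable s h -> game_over h -> client_wins D h.

Definition client_has_winning_strategy (R : realType) (n : nat) (D : R) : Prop :=
  exists s : client_strategy n, winning_strategy D s.

(* Main.v *)
Require Import Defs.
From mathcomp Require Import all_boot all_order all_algebra.
From mathcomp Require Import all_classical all_reals all_analysis.
From mathcomp Require Import ring lra.

Set Implicit Arguments.
Unset Strict Implicit.
Unset Printing Implicit Defensive.

Import Order.TTheory GRing.Theory Num.Theory.
Import numFieldNormedType.Exports.

(** Client keeps the potential [\sum_v (1 + t) ^ dC(v) * (1 - t) ^ dW(v)] from
    growing, where [dC] and [dW] are the degrees in Client's and in Waiter's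
    graph: if Client chose uniformly at random between the two offered edges,
    the summand of a vertex lying on one of them would be multiplied by [1] on
    average, and that of a vertex lying on both by [1 - t ^ 2].  The potential
    starts at [n], so [(1 + t) ^ d * (1 - t) ^ (n - 1 - d) <= n] for every
    Client degree [d].  With [t = tanh x] and [cosh x <= exp (x ^ 2 / 2)] this
    is [x * (2 d - (n - 1)) <= ln n + x ^ 2 * (n - 1) / 2], and
    [x = sqrt (2 * ln n / n)] gives the bound, even with [eps = 0]. *)

(** * Both players' graphs and how a round changes their degrees *)

Section Graphs.
Variable n : nat.
Implicit Types (h : history n) (o G H : {set edge n}) (e f : edge n) (v : 'I_n).

(** Only edges already offered count here; the leftover ones that go to Waiter at the end are
    excluded. *)
Definition waiter_graph h : {set edge n} := offered h :\: client_graph h.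

Lemma offered_rcons h o e : offered (rcons h (o, e)) = o :|: offered h.
Proof. by rewrite /offered big_rcons /= finset.setUC. Qed.

Lemma client_graph_rcons h o e :
  client_graph (rcons h (o, e)) = e |: client_graph h.
Proof.
by apply/setP => f; rewrite !inE map_rcons mem_rcons in_cons.
Qed.

Lemma waiter_graph_rcons h e f : client_graph h \subset offered h ->
  e != f -> f \notin offered h -> e \notin offered h ->
  waiter_graph (rcons h ([set e; f], e)) = f |: waiter_graph h.
Proof.
move=> sCO ef fO eO; rewrite /waiter_graph offered_rcons client_graph_rcons.
apply/setP => g; rewrite finset.in_setD !finset.in_setU !finset.in_set1 finset.in_setD.
have [->|ge] := eqVneq g e; first by rewrite (negPf ef) (negPf eO) andbF.
have [->|//] := eqVneq g f.
have fC : f \notin client_graph h by apply: contra fO; apply: (fintype.subsetP sCO).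
by rewrite fC.
Qed.

Lemma degreeU1 G e v : e \notin G -> degree (e |: G) v = (v \in val e) + degree G v.
Proof.
move=> eG; rewrite /degree; case: (boolP (v \in val e)) => ve.
  rewrite -[RHS](_ : #|e |: [set g in G | v \in val g]| = _).
    by apply: eq_card => g; rewrite !inE; case: eqVneq => [->|]; rewrite ?ve.
  by rewrite cardsU1 inE (negPf eG).
by apply: eq_card => g; rewrite !inE; case: eqVneq => [->|//]; rewrite (negPf ve) !andbF.
Qed.

(** Every edge through [v] in either graph has the form [[set v; u]] with [u] among the [n.-1] other
    vertices, and disjointness prevents double counting. *)
Lemma degree_disjoint G H v : [disjoint G & H] -> degree G v + degree H v <= n.-1.
Proof.
move=> GH; rewrite /degree.
set A := [set e in G | _]; set B := [set e in H | _].
have AB : [disjoint A & B].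
  apply/pred0P => e /=; rewrite !inE; have /= := pred0P GH e.
  by case: (e \in G); case: (e \in H); rewrite ?andbF.
rewrite -cardsUI (disjoint_setI0 AB) cards0 addn0.
have -> : n.-1 = #|[set~ v]| by rewrite cardsC1 card_ord.
rewrite -(card_imset _ val_inj).
apply: leq_trans (leq_imset_card (fun u => [set v; u]) _).
apply: subset_leq_card; apply/fintype.subsetP => _ /imsetP[e eAB ->].
have ve : v \in val e by move: eAB; rewrite !inE => /orP[] /andP[_ ->].
have /cards2P[a [b [ab eab]]] := valP e.
move: ve; rewrite eab !inE => /orP[] /eqP ->; apply/imsetP.
  by exists b; rewrite // !inE eq_sym.
by exists a; [rewrite !inE | rewrite finset.setUC].
Qed.

Lemma legal_offerP h o : legal_offer h o ->
  exists e f, [/\ e != f, o = [set e; f], e \notin offered h & f \notin offered h].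
Proof.
move=> /andP[/cards2P[e [f [ef ->]]] /pred0P dis]; exists e, f; split=> //.
  by have := dis e; rewrite /= !inE eqxx => /= ->.
by have := dis f; rewrite /= !inE eqxx orbT => /= ->.
Qed.

Lemma client_graph_sub_offered {s : client_strategy n} {h} :
  legal_strategy s -> reachable s h -> client_graph h \subset offered h.
Proof.
move=> legs; elim=> [|{}h o _ IH ho]; first by apply/fintype.subsetP => e; rewrite !inE.
rewrite client_graph_rcons offered_rcons finset.setUSS // finset.sub1set.
exact: legs.
Qed.

End Graphs.

Local Open Scope ring_scope.

(** * The potential and the strategy that minimises it greedily *)

Section Potential.
Variables (R : realType) (n : nat) (t : R).
Hypothesis t01 : 0 <= t <= 1.
Implicit Types (h : history n) (o : {set edge n}) (e f : edge n) (v : 'I_n).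

Definition potential h : R :=
  \sum_(v : 'I_n) (1 + t) ^+ degree (client_graph h) v *
                  (1 - t) ^+ degree (waiter_graph h) v.

(** The minimum needs a witness in its range: [pick] finds one in any nonempty offer, and [e0] only
    makes the function total on the empty one. *)
Definition greedy (e0 : edge n) : client_strategy n := fun h o =>
  [arg min_(e < odflt e0 [pick e in o] in o) potential (rcons h (o, e))]%O.

Lemma potential_avg h e f : client_graph h \subset offered h ->
  e != f -> e \notin offered h -> f \notin offered h ->
  potential (rcons h ([set e; f], e)) + potential (rcons h ([set e; f], f))
    <= 2 * potential h.
Proof.
move=> sCO ef eO fO; have /andP[t0 t1] := t01.
rewrite /potential mulr_sumr -big_split /= ler_sum // => v _.
rewrite !client_graph_rcons waiter_graph_rcons // (finset.setUC [set e] [set f]).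
rewrite waiter_graph_rcons 1?eq_sym //.
have nC g : g \notin offered h -> g \notin client_graph h.
  by apply: contra; apply: (fintype.subsetP sCO).
have nW g : g \notin offered h -> g \notin waiter_graph h.
  by apply: contra => /finset.setDP[].
rewrite !degreeU1 ?nC ?nW // !exprD.
set x := (1 + t) ^+ degree _ v; set y := (1 - t) ^+ degree _ v.
have xy : 0 <= x * y by apply: mulr_ge0; apply: exprn_ge0; lra.
(* Half the drop of the summand pair when [v] lies on both edges; in the other three cases the pair
   equals [2 * (x * y)] exactly. *)
have ttxy : 0 <= t * t * (x * y) by apply: mulr_ge0 => //; apply: mulr_ge0.
by case: (v \in val e); case: (v \in val f) => /=; rewrite ?expr0 ?expr1; lra.
Qed.

Variable e0 : edge n.

Lemma greedyP h o : legal_offer h o ->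
  greedy e0 h o \in o /\
  forall e, e \in o ->
    potential (rcons h (o, greedy e0 h o)) <= potential (rcons h (o, e)).
Proof.
move=> /legal_offerP[e [f [_ oef _ _]]]; rewrite /greedy.
case: arg_minP => [|i io imin] //.
case: pickP => //= /(_ e); by rewrite oef !inE eqxx.
Qed.

Lemma greedy_legal : legal_strategy (greedy e0).
Proof. by move=> h o /greedyP[]. Qed.

Lemma potential_greedy {h} : reachable (greedy e0) h -> potential h <= n%:R.
Proof.
elim=> [|{}h o rh IH ho].
  rewrite /potential (eq_bigr (fun=> 1)) ?sumr_const ?card_ord // => v _.
  have C0 : client_graph (@nil ({set edge n} * edge n)) = finset.set0.
    by apply/setP => e; rewrite !inE.
  have d0 : degree finset.set0 v = 0%N.
    by apply/eqP; rewrite cards_eq0; apply/eqP/setP => e; rewrite !inE.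
  by rewrite /waiter_graph /offered big_nil C0 finset.setD0 d0 !expr0 mulr1.
apply: le_trans IH; have [_ gmin] := greedyP ho.
have [e [f [ef oef eO fO]]] := legal_offerP ho.
(* The smaller of the two possible new potentials is at most their average. *)
have := potential_avg (client_graph_sub_offered greedy_legal rh) ef eO fO.
have := gmin e; have := gmin f; rewrite -oef [in f \in _]oef [in e \in _]oef.
rewrite !inE !eqxx orbT => /(_ isT) + /(_ isT); lra.
Qed.

(** One summand is at most the whole potential. Waiter's degree at [v] is at most [k], and as
    [0 <= 1 - t <= 1], raising the exponent to [k] only lowers that summand. *)
Lemma greedy_degree h v : reachable (greedy e0) h ->
  exists2 k, (degree (client_graph h) v + k)%N = n.-1 &
    (1 + t) ^+ degree (client_graph h) v * (1 - t) ^+ k <= n%:R.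
Proof.
move=> rh; have /andP[t0 t1] := t01.
have dis : [disjoint client_graph h & waiter_graph h].
  by apply/pred0P => e /=; rewrite finset.in_setD; case: (e \in client_graph h).
have le_deg := degree_disjoint v dis.
exists (n.-1 - degree (client_graph h) v)%N.
  by rewrite subnKC // (leq_trans (leq_addr _ _) le_deg).
apply: le_trans (potential_greedy rh); rewrite /potential (bigD1 v) //=.
rewrite -[leLHS]addr0 lerD //.
  rewrite ler_wpM2l ?exprn_ge0 //; first lra.
  by apply: ler_wiXn2l; [lra|lra|rewrite leq_subRL // (leq_trans (leq_addr _ _) le_deg)].
by apply: sumr_ge0 => u _; rewrite mulr_ge0 ?exprn_ge0 //; lra.
Qed.

End Potential.

(** * The inequality [cosh x <= exp (x ^ 2 / 2)], by comparing power series *)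

Section Cosh.
Variable R : realType.
Implicit Types x : R.

Lemma fact_double_ge k : (2 ^ k * k`! <= (k.*2)`!)%N.
Proof.
elim: k => // k IH.
rewrite expnS factS mulnACA mul2n doubleS 2!factS leq_mul //.
by rewrite (leq_trans IH) // leq_pmull.
Qed.

Lemma cosh_coeff_le x k : exp_coeff x k.*2 + exp_coeff (- x) k.*2
  <= 2 * exp_coeff (x ^+ 2 / 2) k.
Proof.
have -> : exp_coeff (- x) k.*2 = exp_coeff x k.*2.
  by rewrite /exp_coeff /= -mul2n !exprM sqrrN.
suff : exp_coeff x k.*2 <= exp_coeff (x ^+ 2 / 2) k by lra.
rewrite /exp_coeff /= exprMn -exprM mul2n -mulrA.
rewrite ler_wpM2l ?exprn_even_ge0 ?odd_double // exprVn -invfM.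
rewrite lef_pV2 ?posrE ?mulr_gt0 ?exprn_gt0 ?ltr0n ?fact_gt0 //.
by rewrite -natrX -natrM ler_nat fact_double_ge.
Qed.

(** The odd terms of the two exponentials cancel, so [N.*2] terms on the left match [N] terms on the
    right. *)
Lemma cosh_series_le x N :
  series (exp_coeff x) N.*2 + series (exp_coeff (- x)) N.*2
  <= 2 * series (exp_coeff (x ^+ 2 / 2)) N.
Proof.
elim: N => [|N IH]; first by rewrite /series /= !big_geq // mulr0 addr0.
rewrite doubleS /series /= !big_nat_recr //= -!/(series _ _).
have : exp_coeff (- x) N.*2.+1 = - exp_coeff x N.*2.+1.
  by rewrite /exp_coeff /= exprNn -signr_odd /= odd_double expr1 mulN1r mulNr.
have := cosh_coeff_le x N; rewrite /series /= in IH *; lra.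
Qed.

Lemma cosh_le_expR x : expR x + expR (- x) <= 2 * expR (x ^+ 2 / 2).
Proof.
have dbl : ((fun N => N.*2) @ \oo --> \oo)%classic.
  move=> A [N _ NA]; exists N => // k /= Nk; apply: NA => /=.
  by rewrite -addnn (leq_trans Nk) // leq_addr.
have cvg_expR (y : R) : (series (exp_coeff y) @ \oo --> expR y)%classic.
  exact: is_cvg_series_exp_coeff.
have lhs : (series (exp_coeff x) N.*2 + series (exp_coeff (- x)) N.*2
    @[N --> \oo] --> expR x + expR (- x))%classic.
  by apply: cvgD; [exact: cvg_comp dbl (cvg_expR x)|exact: cvg_comp dbl (cvg_expR (- x))].
have rhs : (2 * series (exp_coeff (x ^+ 2 / 2)) N
    @[N --> \oo] --> 2 * expR (x ^+ 2 / 2))%classic.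
  by apply: cvgM; [exact: cvg_cst|exact: cvg_expR].
exact: ler_cvg_to lhs rhs (nearW _ (cosh_series_le x)).
Qed.

End Cosh.

(** * The degree bound with a free parameter [x] *)

Section Bound.
Variable R : realType.

Lemma client_degree_bound (n : nat) (x : R) : (2 <= n)%N -> 0 <= x ->
  exists2 s : client_strategy n, legal_strategy s &
    forall h, reachable s h -> forall v,
      x * (2 * (degree (client_graph h) v)%:R - n.-1%:R)
        <= ln n%:R + n.-1%:R * (x ^+ 2 / 2).
Proof.
move=> n2 x0.
have e0 : edge n.
  exists (finset.setU [set Ordinal (ltnW n2)] [set Ordinal n2])%SET.
  by rewrite cards2.
(* [c = cosh x] and [t = tanh x]. *)
have [c cE] : exists c : R, 2 * c = expR x + expR (- x).
  by exists ((expR x + expR (- x)) / 2); rewrite mulrC divfK.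
have a0 := expR_gt0 x; have b0 := expR_gt0 (- x).
have c0 : 0 < c by lra.
have ba : expR (- x) <= expR x by rewrite ler_expR; lra.
have [t ct] : exists t : R, 2 * (c * t) = expR x - expR (- x).
  exists ((expR x - expR (- x)) / 2 / c).
  by rewrite [c * _]mulrC divfK ?gt_eqF // mulrC divfK.
have pE : c * (1 + t) = expR x by rewrite mulrDr; lra.
have qE : c * (1 - t) = expR (- x) by rewrite mulrBr; lra.
have t01 : 0 <= t <= 1.
  by rewrite -(ler_pM2l c0) mulr0 -[t <= 1](ler_pM2l c0) mulr1; apply/andP; split; lra.
exists (greedy t e0); first exact: greedy_legal.
move=> h rh v; have [k <-] := greedy_degree t01 v rh.
(* [lra] would try to evaluate the exponent [degree _ v]. *)
move: (degree _ v) => d pq.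
have n0 : 0 < n%:R :> R by rewrite ltr0n ltnW.
(* Multiply [pq] by [c ^+ (d + k)], which turns [1 + t] and [1 - t] into [expR x] and [expR (- x)],
   and bound each [c] by [expR (x ^+ 2 / 2)]. *)
have : expR (x * (d%:R - k%:R)) <= expR (ln n%:R + (d + k)%:R * (x ^+ 2 / 2)).
  have -> : expR (x * (d%:R - k%:R)) = expR x ^+ d * expR (- x) ^+ k.
    by rewrite -!expRM_natl -expRD; congr expR; ring.
  rewrite expRD lnK ?posrE // expRM_natl -pE -qE !exprMn mulrACA -exprD mulrC.
  have /andP[t0 t1] := t01.
  apply: ler_pM => //.
  - by apply: mulr_ge0; apply: exprn_ge0; lra.
  - exact/exprn_ge0/ltW.
  rewrite lerXn2r ?nnegrE ?expR_ge0 ?(ltW c0) //.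
  by have := cosh_le_expR x; lra.
by rewrite ler_expR natrD; lra.
Qed.

End Bound.

Local Open Scope classical_set_scope.

Theorem theorem1p1 (R : realType) :
  exists eps : nat -> R,
    (eps @ \oo --> (0 : R)) /\
    forall n : nat, (2 <= n)%N ->
      client_has_winning_strategy n
        (n%:R / 2 + (1 + eps n) * Num.sqrt (n%:R * ln n%:R / 2)).
Proof.
exists (fun=> 0); split; first exact: cvg_cst.
move=> n n2; rewrite addr0 mul1r.
set L : R := ln n%:R; set S := Num.sqrt _.
have n0 : 0 < n%:R :> R by rewrite ltr0n ltnW.
have L0 : 0 < L by rewrite ln_gt0 // ltr1n.
have S0 : 0 < S by rewrite sqrtr_gt0 divr_gt0 // mulr_gt0.
have SS : S ^+ 2 = n%:R * L / 2 by rewrite sqr_sqrtr // divr_ge0 // mulr_ge0 // ltW.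
(* This is [sqrt (2 * L / n)], which balances the two error terms: [n * x ^ 2 / 2 = L]. *)
pose x := 2 * S / n%:R.
have xn : x * n%:R = 2 * S by rewrite divfK // gt_eqF.
have x0 : 0 < x by rewrite divr_gt0 // mulr_gt0.
have xL : n%:R * (x ^+ 2 / 2) = L.
  have -> : n%:R * (x ^+ 2 / 2) = (x * n%:R) ^+ 2 / n%:R / 2 by field; rewrite gt_eqF.
  by rewrite xn exprMn SS; field; rewrite gt_eqF.
have [s legs sP] := client_degree_bound n2 (ltW x0).
exists s; split=> // h rh _ v; have := sP h rh v.
have nE : n%:R = n.-1%:R + 1 :> R by rewrite natr1 prednK // ltnW.
move: (degree _ v) => d dP.
have x2 : 0 <= x ^+ 2 by rewrite sqr_ge0.
have : x * (2 * d%:R - n.-1%:R) <= x * (2 * S).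
  apply: le_trans dP _; rewrite -/L.
  have -> : x * (2 * S) = L + L by rewrite -xn -{1 2}xL; field.
  by rewrite lerD2l -xL ler_wpM2r ?divr_ge0 // ler_nat leq_pred.
(* Now [2 * d <= n - 1 + 2 * S]; the [- 1] makes the final inequality strict. *)
by rewrite ler_pM2l // nE; lra.
Qed.
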